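(* Let $1\le p<\infty$. Then the Banach spaces $C(\beta\mathbb N\times[1,\omega],\ell_p)$ and $C(\beta\mathbb N,\ell_p)$ are isomorphic.
   Context: For a compact Hausdorff space $K$ and a Banach space $X$, $C(K,X)$ is the Banach space of continuous functions $f:K\to X$ with the supremum norm. $\beta\mathbb N$ is the Stone–Čech compactification of the discrete space $\mathbb N$, and $[1,\omega]$ is the compact space of ordinals between $1$ and $\omega$ in the order topology. ''Isomorphic'' means linearly homeomorphic. *)

(* Defs.v *)
From HB Require Import structures.
From mathcomp Require Import all_boot all_order all_algebra.
From mathcomp Require Import all_classical all_reals all_analysis.
From mathcomp Require Import ring lra.
Set Implicit Arguments.
Unset Strict Implicit.
Unset Printing Implicit Defensive.
Import Order.TTheory GRing.Theory Num.Theory.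
Import numFieldNormedType.Exports.
Local Open Scope classical_set_scope.
Local Open Scope ring_scope.

HB.mixin Record isCompactHausdorff (K : Type) & Topological K := {
  compactT : compact [set: K];
  hausdorffT : hausdorff_space K
}.

#[short(type="compactHausdorffType")]
HB.structure Definition CompactHausdorff :=
  {K of Topological K & isCompactHausdorff K}.

Section prod_compact_hausdorff.
Variables K L : compactHausdorffType.

Let prod_compactT : compact [set: K * L].
Proof. by rewrite -setXTT; apply: compact_setX; exact: compactT. Qed.

Let prod_hausdorffT : hausdorff_space (K * L)%type.
Proof.
move=> [x1 x2] [y1 y2] xy.
congr pair; apply: hausdorffT => A B nA nB.
  have [||[z1 z2] [[/= ? _] [/= ? _]]] := xy (A `*` setT) (B `*` setT).
  - by exists (A, setT) => //=; split => //; exact: filterT.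
  - by exists (B, setT) => //=; split => //; exact: filterT.
  - by exists z1.
have [||[z1 z2] [[/= _ ?] [/= _ ?]]] := xy (setT `*` A) (setT `*` B).
- by exists (setT, A) => //=; split => //; exact: filterT.
- by exists (setT, B) => //=; split => //; exact: filterT.
- by exists z2.
Qed.

HB.instance Definition _ :=
  isCompactHausdorff.Build (K * L)%type prod_compactT prod_hausdorffT.

End prod_compact_hausdorff.

(* The Stone-Cech compactification of the discrete space nat, realized as the
   space of all ultrafilters on nat, with the sets {q | A \in q} as a base of
   open sets.  betaN_dense and betaN_extension give its defining properties. *)
Record betaN := BetaN {
  ultra_sets : set_system nat ;
  ultra_setsP : UltraFilter ultra_sets
}.
#[global] Existing Instance ultra_setsP.

Section betaN_topology.

HB.instance Definition _ := gen_eqMixin betaN.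
HB.instance Definition _ := gen_choiceMixin betaN.

Lemma betaN_eqP (q r : betaN) : ultra_sets q `<=` ultra_sets r -> q = r.
Proof.
case: q r => [F UF] [G UG] /= FG.
have GF : G = F by apply: max_filter => //.
by subst G; congr BetaN; exact: Prop_irrelevance.
Qed.

Lemma betaN_setC (q : betaN) (A : set nat) : ultra_sets q (~` A) <-> ~ ultra_sets q A.
Proof.
split=> [qC qA|qA]; last by case: (in_ultra_setVsetC A (ultra_setsP q)).
by have /filter_ex[n []] : ultra_sets q (A `&` ~` A) by exact: filterI.
Qed.

Definition betaN_cylinder (A : set nat) : set betaN := [set q | ultra_sets q A].

Let cylinder_cover : \bigcup_(A in setT) betaN_cylinder A = setT.
Proof. by apply/seteqP; split=> // q _; exists setT => //; exact: filterT. Qed.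

Let cylinder_join (A B : set nat) (q : betaN) : setT A -> setT B ->
  betaN_cylinder A q -> betaN_cylinder B q ->
  exists C, [/\ setT C, betaN_cylinder C q &
    betaN_cylinder C `<=` betaN_cylinder A `&` betaN_cylinder B].
Proof.
move=> _ _ qA qB; exists (A `&` B); split => //; first exact: filterI.
by move=> r rAB; split; apply: filterS rAB => n [].
Qed.

HB.instance Definition _ :=
  @isBaseTopological.Build betaN (set nat) setT betaN_cylinder
    cylinder_cover cylinder_join.

Lemma nbhs_betaNP (q : betaN) (U : set betaN) :
  nbhs q U <-> exists2 A, ultra_sets q A & betaN_cylinder A `<=` U.
Proof.
split.
  rewrite nbhsE/= => -[B [[D _ <-] [A DA qA]] BU].
  by exists A => //; apply: subset_trans BU => r rA; exists A.
move=> [A qA AU]; rewrite nbhsE; exists (betaN_cylinder A) => //; split => //.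
by exists [set A]; rewrite ?bigcup_set1.
Qed.

Lemma open_betaN_cylinder A : open (betaN_cylinder A).
Proof. by rewrite openE => q qA; apply/nbhs_betaNP; exists A. Qed.

Let betaN_compactT : compact [set: betaN].
Proof.
rewrite compact_ultra => F UF _.
pose G : set_system nat := [set A | F (betaN_cylinder A)].
have GF : ProperFilter G.
  apply: Build_ProperFilter_ex.
    by move=> A /(@filter_ex _ F)[q] /(@filter_ex _ (ultra_sets q)).
  split => [|A B FA FB|A B AB]; rewrite /G/=.
  - apply: (@filterS _ F _ setT) => [q _|]; exact: filterT.
  - by apply: (@filterS _ F) (@filterI _ F _ _ _ FA FB) => q [qA qB]; exact: filterI.
  - by apply: (@filterS _ F) => q; exact: filterS.
have UG : UltraFilter G.
  split=> // H HF GH; apply/seteqP; split => // A HA.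
  have [//|FnA] := in_ultra_setVsetC (betaN_cylinder A) UF.
  have /GH HnA : G (~` A) by apply: filterS FnA => q /betaN_setC.
  by have [n []] := filter_ex (filterI HA HnA).
exists (BetaN UG); split => // U /nbhs_betaNP[A GA AU].
by apply: (@filterS _ F _ _ _ AU); exact: GA.
Qed.

Let betaN_hausdorffT : hausdorff_space betaN.
Proof.
move=> q r qr; apply: betaN_eqP => A qA; apply: contrapT => /betaN_setC rnA.
have [||s [sA snA]] := qr (betaN_cylinder A) (betaN_cylinder (~` A)).
- by apply/nbhs_betaNP; exists A.
- by apply/nbhs_betaNP; exists (~` A).
- by move/betaN_setC : snA.
Qed.

HB.instance Definition _ :=
  isCompactHausdorff.Build betaN betaN_compactT betaN_hausdorffT.

End betaN_topology.

Definition betaN_of_nat (n : nat) : betaN := BetaN (principal_filter_ultra n).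

Lemma betaN_dense : closure (range betaN_of_nat) = setT.
Proof.
apply/seteqP; split => // q _ U /nbhs_betaNP[A /filter_ex[n An] AU].
by exists (betaN_of_nat n); split; [exists n|apply: AU; apply/principal_filterP].
Qed.

Lemma betaN_extension (L : compactHausdorffType) (f : nat -> L) :
  exists! g : betaN -> L, continuous g /\ g \o betaN_of_nat = f.
Proof.
have fcvg (q : betaN) : {l : L | f @ ultra_sets q --> l}.
  apply: cid; have := @compactT L; rewrite compact_ultra.
  have UF : UltraFilter (f @ ultra_sets q).
    split => [|G GF qG]; first exact: fmap_proper_filter.
    apply/seteqP; split => // B GB.
    have [//|qnB] := in_ultra_setVsetC (f @^-1` B) (ultra_setsP q).
    have GnB : G (~` B) by exact: qG.
    by have [n []] := filter_ex (filterI GB GnB).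
  by move=> /(_ _ UF filterT)[l [_ ?]]; exists l.
pose g q := sval (fcvg q).
have gP q : f @ ultra_sets q --> g q by exact: svalP (fcvg q).
have gf : g \o betaN_of_nat = f.
  apply/funext => n /=; apply: (@cvg_unique _ hausdorffT (f @ ultra_sets (betaN_of_nat n))).
    exact: gP.
  move=> U /nbhs_singleton Ufn; exact/principal_filterP.
have gc : continuous g.
  move=> q U /(compact_regular hausdorffT compactT filterT)[V Vq VU].
  have qV : ultra_sets q (f @^-1` V) by exact: gP.
  apply/nbhs_betaNP; exists (f @^-1` V) => // r rV; apply: VU.
  move=> W Wr; have rW : ultra_sets r (f @^-1` W) by exact: gP.
  by have [n [? ?]] := filter_ex (filterI rV rW); exists (f n).
exists g; split => // h [hc hf]; apply/funext => q.
apply: hausdorffT => U V /gc /nbhs_betaNP[A qA AU] /hc /nbhs_betaNP[B qB BV].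
have [n [An Bn]] := filter_ex (filterI qA qB).
exists (f n); split.
  by rewrite -gf; apply: AU; exact/principal_filterP.
by rewrite -hf; apply: BV; exact/principal_filterP.
Qed.

(* The ordinals a with 1 <= a <= omega; ord_fin n is the ordinal n.+1. *)
Inductive ord_1_omega : Type := ord_fin of nat | ord_omega.

Definition option_of_ord (a : ord_1_omega) : option nat :=
  if a is ord_fin n then Some n else None.
Definition ord_of_option (o : option nat) : ord_1_omega :=
  if o is Some n then ord_fin n else ord_omega.
Lemma option_of_ordK : cancel option_of_ord ord_of_option.
Proof. by case. Qed.

HB.instance Definition _ := Choice.copy ord_1_omega (can_type option_of_ordK).

Definition ord_le (a b : ord_1_omega) : bool :=
  match a, b with
  | ord_fin m, ord_fin n => (m <= n)%N
  | ord_omega, ord_fin _ => false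
  | _, ord_omega => true
  end.

Lemma ord_le_anti : antisymmetric ord_le.
Proof. by move=> [m|] [n|]//= /anti_leq ->. Qed.

Lemma ord_le_trans : transitive ord_le.
Proof. by move=> [m|] [n|] [k|]//=; exact: leq_trans. Qed.

Lemma ord_le_total : total ord_le.
Proof. by move=> [m|] [n|]//=; exact: leq_total. Qed.

Fact ord_1_omega_display : Order.disp_t. Proof. exact: Order.Disp tt tt. Qed.

HB.instance Definition _ :=
  @Order.isOrder.Build ord_1_omega_display ord_1_omega ord_le
    (fun a b => (b != a) && ord_le a b)
    (fun a b => if (b != a) && ord_le a b then a else b)
    (fun a b => if (b != a) && ord_le a b then b else a)
    (fun _ _ => erefl) (fun _ _ => erefl) (fun _ _ => erefl)
    ord_le_anti ord_le_trans ord_le_total.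

HB.instance Definition _ :=
  OrderTopological.copy ord_1_omega (order_topology ord_1_omega).

Lemma lt_ord_fin (m n : nat) : (ord_fin m < ord_fin n)%O = (m < n)%N.
Proof.
by rewrite lt_neqAle /Order.le/= /eq_op/= /eq_op/= ltn_neqAle.
Qed.

Lemma lt_ord_omega (n : nat) : (ord_fin n < ord_omega)%O.
Proof. by []. Qed.

Lemma nbhs_ord_omega (U : set ord_1_omega) : nbhs ord_omega U ->
  exists n, forall m, (n <= m)%N -> U (ord_fin m).
Proof.
rewrite itv_nbhsE => -[[l r] [lr olr] lrU].
have {lr olr lrU}[[n|] [xo xU]] :
    exists x, (x < ord_omega)%O /\ forall y, (x < y)%O -> U y.
- move: l r lr olr lrU => [[]l|[]] [[]r|[]]// _; rewrite in_itv/= ?andbT => lo.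
  + by case/andP: lo => _; case: r.
  + move=> lU; exists l; split; first exact: lo.
    by move=> y ly; apply: lU; rewrite /= in_itv/= ly.
  + by case: r lo.
  + by move=> lU; exists (ord_fin 0); split => // y _; apply: lU; rewrite /= in_itv.
- by exists n.+1 => m nm; apply: xU; rewrite lt_ord_fin.
- by rewrite ltxx in xo.
Qed.

Section ord_1_omega_compact.

Let ord_compactT : compact [set: ord_1_omega].
Proof.
rewrite compact_ultra => F UF _.
have [Fo|] := pselect (F --> ord_omega); first by exists ord_omega.
move/existsNP => [U /not_implyP[oU nFU]].
have [n nU] := nbhs_ord_omega oU.
pose A := [set ord_fin m | m in `I_n].
have : compact A by apply: finite_compact; exact: finite_image.
rewrite compact_ultra => /(_ F UF)[]; last by move=> x [_ Fx]; exists x.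
have [//|FU] := in_ultra_setVsetC U UF.
apply: (@filterS _ F _ _ _ _ FU) => -[m|] nUm; last first.
  by exfalso; apply: nUm; exact: nbhs_singleton oU.
exists m => //=; rewrite ltnNge; apply/negP => /nU; exact: nUm.
Qed.

Let ord_hausdorffT : hausdorff_space ord_1_omega.
Proof. exact: order_hausdorff. Qed.

HB.instance Definition _ :=
  isCompactHausdorff.Build ord_1_omega ord_compactT ord_hausdorffT.

End ord_1_omega_compact.

(* With the supremum norm (sup_norm below). The supremum of the empty set is 0
   in R, so that the norm is also right for empty K. *)
Definition Cspace (R : realType) (K : compactHausdorffType)
  (X : normedModType R) : Type := continuousType K X.

Section Cspace_lmodule.
Variables (R : realType) (K : compactHausdorffType) (X : normedModType R).

Definition continuous_pred : {pred K -> X} := mem [set f | continuous f].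

Let Cspace_val (f : Cspace K X) : K -> X := f.

Let Cspace_Sub (f : K -> X) (cf : f \in continuous_pred) : Cspace K X :=
  mkcts (set_mem cf).

Let Cspace_rect (P : Cspace K X -> Type) :
  (forall f (cf : f \in continuous_pred), P (Cspace_Sub cf)) -> forall f, P f.
Proof.
move=> PS f.
have cf : Cspace_val f \in continuous_pred by apply/mem_set; exact: cts_fun.
suff -> : f = Cspace_Sub cf by [].
by apply/continuousEP.
Qed.

Let Cspace_SubK (f : K -> X) (cf : f \in continuous_pred) :
  Cspace_val (Cspace_Sub cf) = f.
Proof. by []. Qed.

HB.instance Definition _ :=
  isSub.Build (K -> X) continuous_pred (Cspace K X) Cspace_rect Cspace_SubK.
HB.instance Definition _ := [Choice of Cspace K X by <:].

Let continuous_submod_closed : submod_closed continuous_pred.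
Proof.
split=> [|a f g /set_mem/= cf /set_mem/= cg]; apply/mem_set => /= t.
  exact: cvg_cst.
by apply: cvgD; [apply: cvgZl_tmp; exact: cf|exact: cg].
Qed.

HB.instance Definition _ := GRing.isSubmodClosed.Build _ _ continuous_pred
  continuous_submod_closed.
HB.instance Definition _ := [SubChoice_isSubLmodule of Cspace K X by <:].

End Cspace_lmodule.
Section Cspace_norm.
Variables (R : realType) (K : compactHausdorffType) (X : normedModType R).
Implicit Types f g : Cspace K X.

Definition sup_norm f : R := sup [set `|f t| | t in [set: K]].

Let has_ubound_norm f : has_ubound [set `|f t| | t in [set: K]].
Proof.
have : compact [set `|f t| | t in [set: K]].
  apply: continuous_compact; last exact: compactT.
  apply: continuous_subspaceT => t.
  apply: (@continuous_comp _ _ _ f (fun x : X => `|x|)); first exact: cts_fun.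
  exact: norm_continuous.
move=> /compact_bounded[M [_ /(_ (M + 1))]].
rewrite ltrDl ltr01 => /(_ isT) fM; exists (M + 1) => _ [t _ <-].
by rewrite -(normr_id (f t)); apply: fM; exists t.
Qed.

Lemma ler_sup_norm f t : `|f t| <= sup_norm f.
Proof. by apply: ub_le_sup => //; exists t. Qed.

Lemma sup_norm_ge0 f : 0 <= sup_norm f.
Proof.
have [[t _]|K0] := pselect ([set: K] !=set0).
  by apply: le_trans _ (ler_sup_norm f t).
rewrite /sup_norm (_ : [set _ | _ in _] = set0) ?sup0//.
by apply/seteqP; split => // y [t] _ _; apply: K0; exists t.
Qed.

Lemma sup_norm_le f (M : R) :
  0 <= M -> (forall t, `|f t| <= M) -> sup_norm f <= M.
Proof.
move=> M0 fM; have [[t _]|K0] := pselect ([set: K] !=set0).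
  by apply: ge_sup => [|_ [s _ <-]//]; exists `|f t|; exists t.
rewrite /sup_norm (_ : [set _ | _ in _] = set0) ?sup0//.
by apply/seteqP; split => // y [t] _ _; apply: K0; exists t.
Qed.

Let sup_normD f g : sup_norm (f + g) <= sup_norm f + sup_norm g.
Proof.
apply: sup_norm_le => [|t]; first by rewrite addr_ge0// sup_norm_ge0.
by apply: le_trans (ler_normD _ _) _; apply: lerD; exact: ler_sup_norm.
Qed.

Let sup_normZ_le (a : R) f : sup_norm (a *: f) <= `|a| * sup_norm f.
Proof.
apply: sup_norm_le => [|t]; first by rewrite mulr_ge0// sup_norm_ge0.
rewrite [X in `|X|](_ : _ = a *: f t)// normrZ.
by apply: ler_wpM2l => //; exact: ler_sup_norm.
Qed.

Let sup_normZ (a : R) f : sup_norm (a *: f) = `|a| * sup_norm f.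
Proof.
apply/eqP; rewrite eq_le sup_normZ_le/=; have [->|a0] := eqVneq a 0.
  by rewrite normr0 mul0r sup_norm_ge0.
rewrite -ler_pdivlMl ?normr_gt0// -normfV.
by have := sup_normZ_le a^-1 (a *: f); rewrite scalerA mulVf// scale1r.
Qed.

Let sup_norm0_eq0 f : sup_norm f = 0 -> f = 0.
Proof.
move=> f0; apply/continuousEP => t; apply/eqP.
by rewrite -normr_le0 -f0; exact: ler_sup_norm.
Qed.

HB.instance Definition _ := Lmodule_isNormed.Build R (Cspace K X)
  sup_normD sup_normZ sup_norm0_eq0.

Lemma CspaceNormE f : `|f| = sup_norm f. Proof. by []. Qed.

End Cspace_norm.

Section Cspace_complete.
Variables (R : realType) (K : compactHausdorffType).
Variable X : completeNormedModType R.

Let Cspace_complete (F : set_system (Cspace K X)) :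
  ProperFilter F -> cauchy F -> cvg F.
Proof.
move=> FF /cauchy_ballP cF.
have Fe (e : R) : 0 < e -> exists2 A, F A &
    forall f g t, A f -> A g -> `|f t - g t| < e.
  move=> e0; have [[A B] /= [FA FB] AB] := cF e e0.
  exists (A `&` B) => [|f g t [Af _] [_ Bg]]; first exact: filterI.
  have := AB (f, g); rewrite -ball_normE/= => /(_ (conj Af Bg)).
  exact: le_lt_trans (ler_sup_norm (f - g) t).
have cFt t : cvg (f t @[f --> F]).
  apply: cauchy_cvg; apply/cauchy_ballP => e e0.
  have [A FA AB] := Fe e e0.
  exists ([set f t | f in A], [set f t | f in A]) => [|[x y]/=].
    by split; apply: (@filterS _ F _ _ _ _ FA) => f Af; exists f.
  by move=> [[f Af <-] [g Ag <-]]; rewrite -ball_normE/=; exact: AB.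
pose g t := lim (f t @[f --> F]).
have Fg (e : R) : 0 < e -> exists2 A, F A & forall f t, A f -> `|f t - g t| <= e.
  move=> e0; have [A FA AB] := Fe e e0; exists A => // f t Af.
  have : `|f t - h t| @[h --> F] --> `|f t - g t|.
    by apply: cvg_norm; apply: cvgB; [exact: cvg_cst|exact: cFt].
  move=> /(@cvg_lim _ (@Rhausdorff R)) <-; apply: limr_le.
    by apply: is_cvg_norm; apply: is_cvgB; [exact: is_cvg_cst|exact: cFt].
  apply: (@filterS _ F _ _ _ _ FA) => h Ah; apply: ltW. exact: AB.
have cg : continuous g.
  move=> t; apply/cvgrPdist_lt => e e0.
  have e3 : 0 < e / 3 by rewrite divr_gt0.
  have [A /filter_ex[f Af] AB] := Fg _ e3.
  have /cvgrPdist_lt/(_ _ e3) := @cts_fun _ _ f t.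
  apply: filterS => s fts.
  rewrite (_ : g t - g s = - (f t - g t) + (f t - f s) + (f s - g s)); last first.
    by rewrite opprB !addrA subrK subrK.
  apply: le_lt_trans (ler_normD _ _) _.
  rewrite (_ : e = e / 3 + e / 3 + e / 3); last by field.
  apply: ltr_leD; last exact: AB.
  apply: le_lt_trans (ler_normD _ _) _.
  by apply: ler_ltD => //; rewrite normrN; exact: AB.
apply/cvg_ex; exists (mkcts cg : Cspace K X).
apply/cvgrPdist_le => e e0; have [A FA AB] := Fg e e0.
apply: filterS FA => f Af; apply: sup_norm_le => [|t]; first exact: ltW.
by rewrite -normrN; have := AB f t Af; rewrite -opprB.
Qed.

HB.instance Definition _ :=
  Uniform_isComplete.Build (Cspace K X) Cspace_complete.

End Cspace_complete.

Definition lp_exponent (R : realType) (p : R) (p1 : 1 <= p) :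
  (1 <= p%:E)%E := etrans (lee_fin 1 p) p1.

(* l_p is L_p of the counting measure on nat; the only negligible set is empty,
   so no quotient is needed.  See lp_normE for the norm as a series. *)
Definition lp (R : realType) (p : R) (p1 : 1 <= p) : Type :=
  LfunType (@counting nat R) (lp_exponent p1).

Section lp_norm.
Variables (R : realType) (p : R) (p1 : 1 <= p).
Local Notation mu := (@counting nat R).
Implicit Types x y : lp p1.

HB.instance Definition _ := GRing.Lmodule.on (lp p1).

Let p_gt0 : 0 < p. Proof. exact: lt_le_trans p1. Qed.

Definition lp_norm x : R := fine ('N[mu]_p%:E [EFin \o x])%E.

Lemma lp_normE x :
  (lp_norm x)%:E = ((\sum_(k <oo) (`|x k| `^ p)%:E) `^ p^-1)%E.
Proof. by rewrite /lp_norm finite_norm_fine Lnorm_counting. Qed.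

Let lp_normD x y : lp_norm (x + y) <= lp_norm x + lp_norm y.
Proof. exact: ler_LnormD. Qed.

Let lp_normZ (a : R) x : lp_norm (a *: x) = `|a| * lp_norm x.
Proof.
by rewrite /lp_norm -[RHS]/(fine `|a|%:E * _) -fineM ?fin_numE// -?LnormZ//;
  rewrite -finite_norm_fine.
Qed.

Lemma lp_norm_sum_le x n :
  \sum_(k < n) `|x k| `^ p <= lp_norm x `^ p.
Proof.
rewrite -lee_fin -poweR_EFin lp_normE -poweRrM mulVf ?gt_eqF// poweRe1; last first.
  by apply: nneseries_ge0 => k _ _; rewrite lee_fin powR_ge0.
rewrite -sumEFin -(big_mkord xpredT (fun k => (`|x k| `^ p)%:E)).
by apply: nneseries_lim_ge => k _ _; rewrite lee_fin powR_ge0.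
Qed.

Lemma ler_lp_norm x k : `|x k| <= lp_norm x.
Proof.
have xk : `|x k| `^ p <= lp_norm x `^ p.
  apply: le_trans (lp_norm_sum_le x k.+1).
  by rewrite big_ord_recr/= lerDr sumr_ge0// => i _; exact: powR_ge0.
have nx : 0 <= lp_norm x by rewrite -lee_fin lp_normE poweR_ge0.
rewrite leNgt; apply/negP => xlt; move: xk; rewrite leNgt => /negP; apply.
by apply: gt0_ltr_powR; rewrite ?nnegrE.
Qed.

Let lp_norm0_eq0 x : lp_norm x = 0 -> x = 0.
Proof.
move=> x0; apply/LfuneqP => k; apply/eqP.
by rewrite -normr_le0 -x0; exact: ler_lp_norm.
Qed.

HB.instance Definition _ := Lmodule_isNormed.Build R (lp p1)
  lp_normD lp_normZ lp_norm0_eq0.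

Lemma lpNormE x : `|x| = lp_norm x. Proof. by []. Qed.

End lp_norm.

Section lp_complete.
Variables (R : realType) (p : R) (p1 : 1 <= p).

Let p_gt0 : 0 < p. Proof. exact: lt_le_trans p1. Qed.

Lemma cvg_powR (T : Type) (F : set_system T) (FF : ProperFilter F) (f : T -> R) (l : R) :
  (forall t, 0 <= f t) -> f @ F --> l -> (f t) `^ p @[t --> F] --> l `^ p.
Proof.
move=> f0 fl; have [l0|l0|l0] := ltgtP l 0.
- have : 0 <= l.
    have := fl => /(@cvg_lim _ (@Rhausdorff R)) <-; apply: limr_ge.
      by apply/cvg_ex; exists l.
    by apply: nearW.
  by rewrite leNgt l0.
- apply: (@cvg_comp _ _ _ f (fun a : R => a `^ p) _ _ _ fl).
  have : derivable (fun a : R => a `^ p) l 1.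
    by apply: derivable_powR; rewrite in_itv/= l0.
  by move/derivable1_diffP/differentiable_continuous.
- rewrite l0 powR0 ?gt_eqF//; apply/cvgrPdist_lt => e e0.
  move: fl; rewrite l0 => /cvgrPdist_lt/(_ (e `^ p^-1) (powR_gt0 _ e0)).
  apply: filterS => t; rewrite !sub0r !normrN (ger0_norm (f0 t)).
  rewrite ger0_norm ?powR_ge0// => /(gt0_ltr_powR p_gt0).
  rewrite !nnegrE f0 powR_ge0 => /(_ isT isT).
  by rewrite -powRrM mulVf ?gt_eqF// powRr1 ?ltW.
Qed.

Let lp_complete (F : set_system (lp p1)) : ProperFilter F -> cauchy F -> cvg F.
Proof.
move=> FF /cauchy_ballP cF.
have Fe (e : R) : 0 < e -> exists2 A, F A &
    forall f g, A f -> A g -> `|f - g| <= e.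
  move=> e0; have [[A B] /= [FA FB] AB] := cF e e0.
  exists (A `&` B) => [|f g [Af _] [_ Bg]]; first exact: filterI.
  by have := AB (f, g); rewrite -ball_normE/= => /(_ (conj Af Bg))/ltW.
have cFk (k : nat) : cvg (f k @[f --> F]).
  apply: cauchy_cvg; apply/cauchy_ballP => e e0.
  have e2 : 0 < e / 2 by rewrite divr_gt0.
  have [A FA AB] := Fe _ e2.
  exists ([set f k | f in A], [set f k | f in A]) => [|[x y]/=].
    by split; apply: (@filterS _ F _ _ _ _ FA) => f Af; exists f.
  move=> [[f Af <-] [g Ag <-]]; rewrite -ball_normE/=.
  apply: le_lt_trans (_ : e / 2 < e); last by rewrite gtr_pMr// invf_lt1// ltr1n.
  by apply: le_trans (AB f g Af Ag); exact: (ler_lp_norm (f - g)).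
pose g (k : nat) := lim (f k @[f --> F]).
have gsum (e : R) (A : set (lp p1)) (n : nat) f : F A -> 0 < e ->
    (forall f g, A f -> A g -> `|f - g| <= e) -> A f ->
    \sum_(k < n) `|f k - g k| `^ p <= e `^ p.
  move=> FA e0 AB Af.
  have hc : (fun h : lp p1 => \sum_(k < n) `|f k - h k| `^ p) @ F -->
            \sum_(k < n) `|f k - g k| `^ p.
    apply: cvg_big => [|k _]; first exact: add_continuous.
    apply: cvg_powR => //.
    by apply: cvg_norm; apply: cvgB; [exact: cvg_cst|exact: cFk].
  rewrite -(cvg_lim (@Rhausdorff R) hc); apply: limr_le.
    by apply/cvg_ex; eexists; exact: hc.
  apply: (@filterS _ F _ _ _ _ FA) => h Ah.
  apply: le_trans (lp_norm_sum_le (f - h) n) _.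
  have fh : lp_norm (f - h) <= e by exact: AB.
  apply: ge0_ler_powR fh; rewrite ?nnegrE ?(ltW p_gt0) ?(ltW e0)//.
  exact: (normr_ge0 (f - h)).
have mem_lp (u : nat -> R) (M : R) : 0 <= M ->
    (forall n, \sum_(k < n) `|u k| `^ p <= M `^ p) ->
    u \in Lfun (@counting nat R) p%:E /\
    ('N[(@counting nat R)]_p%:E [EFin \o u] <= M%:E)%E.
  move=> M0 uM.
  have uN : ('N[(@counting nat R)]_p%:E [EFin \o u] <= M%:E)%E.
    rewrite Lnorm_counting//.
    have -> : M%:E = ((M `^ p)%:E `^ p^-1)%E.
      by rewrite poweR_EFin -powRrM mulfV ?gt_eqF// powRr1.
    have un0 k : (0%N <= k)%N -> true -> (0 <= (`|u k| `^ p)%:E)%E.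
      by rewrite lee_fin powR_ge0.
    apply: gt0_ler_poweR; rewrite ?invr_ge0 ?(ltW p_gt0)// ?in_itv/= ?leey ?andbT.
    - exact: nneseries_ge0.
    - by rewrite lee_fin powR_ge0.
    apply: lime_le; first exact: is_cvg_nneseries.
    by apply: nearW => n; rewrite big_mkord sumEFin lee_fin; exact: uM.
  split => //; apply/andP; split; first exact/mem_set.
  by apply/mem_set; rewrite /= /finite_norm (le_lt_trans uN)// ltry.
have [A1 FA1 A11] := Fe 1 ltr01.
have /filter_ex[f Af] := FA1.
have [du _] := mem_lp (fun k => f k - g k) 1 ler01
  (fun n => gsum 1 A1 n f FA1 ltr01 A11 Af).
pose d : lp p1 := Lfun_Sub (lp_exponent p1) du.
apply/cvg_ex; exists (f - d); apply/cvgrPdist_le => e e0.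
have [A FA Ae] := Fe e e0.
apply: (@filterS _ F _ _ _ _ FA) => h Ah.
rewrite distrC.
have [_ hg] := mem_lp (fun k => h k - g k) e (ltW e0)
  (fun n => gsum e A n h FA e0 Ae Ah).
rewrite -lee_fin lpNormE /lp_norm finite_norm_fine.
rewrite (_ : EFin \o _ = EFin \o (fun k => h k - g k))//.
apply/funext => k /=; congr EFin.
by rewrite -[LHS]/(h k - (f k - (f k - g k))) subKr.
Qed.

HB.instance Definition _ := Uniform_isComplete.Build (lp p1) lp_complete.

End lp_complete.

Definition isomorphic (R : realType) (X Y : completeNormedModType R) : Prop :=
  exists (T : {linear X -> Y}) (S : Y -> X),
    [/\ cancel T S, cancel S T, continuous T & continuous S].

(* Main.v *)
(* Write E = C(betaN, l_p).  The space betaN contains pairwise disjoint clopen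
   copies of itself, the closures of the members of a partition of nat into
   infinite sets, and the right shifts of l_p have left inverses (the left
   shifts) converging pointwise to 0.  Restricting f : E to the n-th copy and
   shifting it n times to the left gives a sequence in E which is null because
   f has compact range, and every null sequence of E arises in this way from its
   glueing.  So c_0(E) is complemented in E, say E = c_0(E) + W.  A continuous
   function on betaN * [1, omega] is a convergent sequence in E, i.e. an element
   of E + c_0(E) = W + c_0(E) + c_0(E), and interleaving the two null sequences
   identifies this space with W + c_0(E) = E. *)
Require Import Defs.
From HB Require Import structures.
From mathcomp Require Import all_boot all_order all_algebra.
From mathcomp Require Import all_classical all_reals all_analysis.
From mathcomp Require Import ring.
Import Order.TTheory GRing.Theory Num.Theory.
Import numFieldNormedType.Exports.
Local Open Scope classical_set_scope.
Local Open Scope ring_scope.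

(** * Neighbourhoods in [ord_1_omega], and continuity of bounded operators *)

Lemma ord_finite_nbhs (n : nat) : nbhs (ord_fin n) [set ord_fin n].
Proof.
rewrite itv_nbhsE; case: n => [|n].
  exists (`]-oo, ord_fin 1[%O).
    by split => //; rewrite in_itv/= lt_ord_fin.
  move=> [[|m]|]; rewrite /= ?in_itv//=.
  by rewrite lt_ord_fin.
exists (`]ord_fin n, ord_fin n.+2[%O).
  by split => //; rewrite in_itv/= !lt_ord_fin !ltnSn.
move=> [m|]; rewrite /= ?in_itv/= ?andbF//.
by rewrite !lt_ord_fin !ltnS -eqn_leq => /eqP ->.
Qed.

Lemma ord_infinite_nbhs (N : nat) :
  nbhs ord_omega [set a | if a is ord_fin n then (N <= n)%N else true].
Proof.
rewrite itv_nbhsE; exists (`]ord_fin N, +oo[%O); first by split.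
by move=> [m|]//; rewrite /= in_itv/= andbT lt_ord_fin => /ltnW.
Qed.

Lemma bounded_continuous {R : realType} {U V : normedModType R}
  (f : {linear U -> V}) (C : R) :
  (forall x, `|f x| <= C * `|x|) -> continuous f.
Proof.
move=> fC; apply: bounded_linear_continuous; apply/linear_boundedP.
exists C; split => [|r Cr x]; first exact: num_real.
by apply: le_trans (fC x) _; apply: ler_wpM2r => //; exact: ltW.
Qed.

(** * The isomorphism for a compact space with disjoint open copies of itself *)

Section self_similar.
Set Implicit Arguments.
Unset Strict Implicit.
Variables (R : realType) (K : compactHausdorffType) (X : completeNormedModType R).
Variables (e : nat -> K -> K) (d : K -> K).
Hypothesis e_continuous : forall n, continuous (e n).
Hypothesis d_continuous : continuous d.
Hypothesis eK : forall n, cancel (e n) d.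
Hypothesis e_disjoint : forall m n q r, e m q = e n r -> m = n.
Hypothesis e_open : forall n, open (range (e n)).
(** For [lp] these are the right and left shifts by [n]. *)
Variables inc prj : nat -> {linear X -> X}.
Hypothesis ler_inc : forall n x, `|inc n x| <= `|x|.
Hypothesis ler_prj : forall n x, `|prj n x| <= `|x|.
Hypothesis incK : forall n, cancel (inc n) (prj n).
Hypothesis cvg_prj : forall x, prj n x @[n --> \oo] --> (0 : X).

Lemma contraction_continuous (f : {linear X -> X}) :
  (forall x, `|f x| <= `|x|) -> continuous f.
Proof.
by move=> fle; apply: (bounded_continuous f 1) => x; rewrite mul1r.
Qed.

(** Convergence to 0 in the supremum norm, for bare functions, so that continuity is tracked
    separately. *)
Definition vanishing (h : nat -> K -> X) :=
  forall eps, 0 < eps -> \forall n \near \oo, forall r, `|h n r| <= eps.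

Lemma vanishingB (h k : nat -> K -> X) : vanishing h -> vanishing k ->
  vanishing (fun n r => h n r - k n r).
Proof.
move=> h0 k0 eps eps0; have eps2 : 0 < eps / 2 by rewrite divr_gt0.
near=> n => r; rewrite (splitr eps).
apply: le_trans (ler_normB _ _) _; apply: lerD.
  by move: r; near: n; exact: h0.
by move: r; near: n; exact: k0.
Unshelve. all: by end_near. Qed.

(** * Slicing a function along the copies, and glueing a null sequence over them *)

Definition slice (f : K -> X) n : K -> X := fun r => prj n (f (e n r)).

Lemma slice_continuous f n : continuous f -> continuous (slice f n).
Proof.
move=> fc r; apply: (continuous_comp (g := prj n)).
  by apply: continuous_comp => //; [exact: e_continuous|exact: fc].
exact: contraction_continuous.
Qed.

Lemma slice_le f n M r : (forall q, `|f q| <= M) -> `|slice f n r| <= M.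
Proof. by move=> fM; apply: le_trans (ler_prj _ _) (fM _). Qed.

(* [prj n] converges to 0 pointwise and is equicontinuous, so it converges to 0
   uniformly on the compact range of [f]. *)
Lemma slice_vanishing f : continuous f -> vanishing (slice f).
Proof.
move=> fc eps eps0; have eps2 : 0 < eps / 2 by rewrite divr_gt0.
suff cov q : [set: K] q ->
    \forall r \near q & n \near \oo, `|prj n (f r)| <= eps.
  have [N _ NP] := (compact_near_coveringP _).1 compactT _ _ _ _ cov.
  by exists N => // n Nn r; exact: NP.
move=> _.
have /cvgrPdist_le/(_ _ eps2) nf := fc q.
have /cvgrPdist_le/(_ _ eps2) np := @cvg_prj (f q).
exists ([set r | `|f q - f r| <= eps / 2],
        [set n | `|0 - prj n (f q)| <= eps / 2]) => // -[r n] [/= rq nq].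
rewrite -[f r](subKr (f q)) linearB (splitr eps).
apply: le_trans (ler_normB _ _) _; apply: lerD.
  by move: nq; rewrite sub0r normrN.
by apply: le_trans rq.
Qed.

Definition glue (h : nat -> K -> X) (q : K) : X :=
  if pselect (exists n, range (e n) q) is left E
  then inc (sval (cid E)) (h (sval (cid E)) (d q)) else 0.

Lemma glueE h n r : glue h (e n r) = inc n (h n r).
Proof.
rewrite /glue; case: pselect => [E|[]]; last by exists n; exists r.
by case: cid => m /= [s _ /e_disjoint ->]; rewrite eK.
Qed.

Lemma glue0 h q : (forall n r, q <> e n r) -> glue h q = 0.
Proof.
by move=> qn; rewrite /glue; case: pselect => // E; have [n [r _ /esym/qn]] := E.
Qed.

Lemma range_or_not q :
  (exists n r, q = e n r) \/ (forall n r, q <> e n r).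
Proof.
have [E|E] := pselect (exists n r, q = e n r); [by left|right => n r qr].
by apply: E; exists n, r.
Qed.

(** On the open range of [e n] the glueing is [inc n \o h n \o d]. At a point off all copies it is
    0, and values above a given bound occur on finitely many copies only; these are compact, hence
    closed, and stay away from the point. *)
Lemma glue_continuous h : (forall n, continuous (h n)) -> vanishing h ->
  continuous (glue h).
Proof.
move=> hc h0 q; have [[n [r ->]]|qn] := range_or_not q.
  rewrite /continuous_at glueE -{2}(eK n r).
  have hnd : (inc n \o h n \o d) s @[s --> e n r] --> inc n (h n (d (e n r))).
    apply: (continuous_comp (f := d) (g := inc n \o h n)); first exact: d_continuous.
    apply: (continuous_comp (f := h n) (g := inc n)); first exact: hc.
    exact: contraction_continuous.
  apply: cvg_trans hnd; apply: near_eq_cvg.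
  have : nbhs (e n r) (range (e n)) by apply: open_nbhs_nbhs; split => //; exists r.
  by apply: filterS => s [t _ <-] /=; rewrite glueE eK.
apply/cvgrPdist_le => eps eps0; rewrite (glue0 h qn).
have [N _ hN] := h0 eps eps0.
have : \forall s \near q, forall i : 'I_N, ~ range (e i) s.
  apply: filter_forall => i; apply: open_nbhs_nbhs; split.
    apply: closed_openC; apply: (compact_closed hausdorffT).
    apply: continuous_compact; last exact: compactT.
    by apply: continuous_subspaceT; exact: e_continuous.
  by move=> [r _ /esym/qn].
apply: filterS => s sN; rewrite sub0r normrN.
have [[n [r sE]]|/(glue0 h) ->] := range_or_not s; last by rewrite normr0 ltW.
rewrite sE glueE; apply: le_trans (ler_inc _ _) _.
apply: hN => /=; rewrite leqNgt; apply/negP => nN.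
by apply: (sN (Ordinal nN)); exists r.
Qed.

Lemma glue_le h M q : 0 <= M -> (forall n r, `|h n r| <= M) -> `|glue h q| <= M.
Proof.
move=> M0 hM; have [[n [r ->]]|/(glue0 h) ->] := range_or_not q.
  by rewrite glueE; apply: le_trans (hM n r).
by rewrite normr0.
Qed.

(** * Functions on [K * ord_1_omega] as a limit plus a null sequence *)

Definition limit_part (g : K * ord_1_omega -> X) : K -> X := fun q => g (q, ord_omega).

Definition null_part (g : K * ord_1_omega -> X) (n : nat) : K -> X :=
  fun q => g (q, ord_fin n) - g (q, ord_omega).

Lemma section_continuous (g : K * ord_1_omega -> X) a :
  continuous g -> continuous (fun q => g (q, a)).
Proof.
move=> gc q; apply: (continuous_comp (f := fun q => (q, a))); last exact: gc.
exact: (cvg_pair (G := nbhs q) (H := nbhs a) cvg_id (cvg_cst a)).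
Qed.

Lemma null_part_continuous g n : continuous g -> continuous (null_part g n).
Proof.
by move=> gc q; apply: cvgB; exact: section_continuous.
Qed.

(** Continuity at [(q, ord_omega)] makes the differences small near [q] from some index on;
    compactness of [K] makes this index uniform. *)
Lemma null_part_vanishing g : continuous g -> vanishing (null_part g).
Proof.
move=> gc eps eps0; have eps2 : 0 < eps / 2 by rewrite divr_gt0.
suff cov q : [set: K] q ->
    \forall r \near q & n \near \oo, `|null_part g n r| <= eps.
  have [N _ NP] := (compact_near_coveringP _).1 compactT _ _ _ _ cov.
  by exists N => // n Nn r; exact: NP.
move=> _.
have /cvgrPdist_le/(_ _ eps2)[[A B]/= [Aq Bo] AB] := gc (q, ord_omega).
have [N BN] := nbhs_ord_omega Bo.
exists (A, [set n | (N <= n)%N]); first by split => //; exists N.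
move=> [r n] [/= Ar Nn]; rewrite /null_part.
rewrite (_ : _ - _ = (g (q, ord_omega) - g (r, ord_omega))
                     - (g (q, ord_omega) - g (r, ord_fin n))); last first.
  by rewrite opprB [RHS]addrC addrA subrK.
rewrite (splitr eps); apply: le_trans (ler_normB _ _) _; apply: lerD.
  by apply: (AB (r, _)); split => //=; exact: nbhs_singleton Bo.
by apply: (AB (r, _)); split => //=; exact: BN.
Qed.

Definition assemble (l : K -> X) (h : nat -> K -> X) (qa : K * ord_1_omega) : X :=
  l qa.1 + if qa.2 is ord_fin n then h n qa.1 else 0.

(** Finite ordinals are isolated, so the uniform smallness of [h] matters at [ord_omega] only. *)
Lemma assemble_continuous l h : continuous l -> (forall n, continuous (h n)) ->
  vanishing h -> continuous (assemble l h).
Proof.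
move=> lc hc h0 [q a].
have lc1 : l qa.1 @[qa --> (q, a)] --> l q.
  by apply: continuous_comp; [exact: cvg_fst|exact: lc].
apply: cvgD => //=; case: a lc1 => [n|] _.
  have hn : h n qa.1 @[qa --> (q, ord_fin n)] --> h n q.
    by apply: continuous_comp; [exact: cvg_fst|exact: hc].
  apply: cvg_trans hn; apply: near_eq_cvg.
  exists (setT, [set ord_fin n]).
    by split; [exact: filterT|exact: ord_finite_nbhs].
  by move=> [r a] [_ /= ->].
apply/cvgrPdist_le => eps eps0; have [N _ hN] := h0 eps eps0.
exists (setT, [set a | if a is ord_fin n then (N <= n)%N else true]).
  by split; [exact: filterT|exact: ord_infinite_nbhs].
move=> [r [n|]] [_ /= Nn]; rewrite sub0r normrN ?normr0 ?(ltW eps0)//.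
exact: hN.
Qed.

(* The even terms are the differences to the limit of the sequence [g], the odd
   ones the slices of that limit. *)
Definition coords (g : K * ord_1_omega -> X) (n : nat) : K -> X :=
  if odd n then slice (limit_part g) n./2 else null_part g n./2.

Lemma coords_even g n : coords g n.*2 = null_part g n.
Proof. by rewrite /coords odd_double doubleK. Qed.

Lemma coords_odd g n : coords g n.*2.+1 = slice (limit_part g) n.
Proof. by rewrite /coords /= odd_double uphalf_double. Qed.

Lemma coords_continuous g n : continuous g -> continuous (coords g n).
Proof.
move=> gc; rewrite /coords; case: ifP => _; last exact: null_part_continuous.
by apply: slice_continuous; exact: section_continuous.
Qed.

Lemma coords_vanishing g : continuous g -> vanishing (coords g).
Proof.
move=> gc eps eps0.
have [N _ slN] := slice_vanishing (section_continuous (a := ord_omega) gc) eps0.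
have [M _ npM] := null_part_vanishing gc eps0.
(* The threshold is doubled because [coords] reads index [n./2]. *)
exists (maxn N M).*2 => // n /= nNM r.
have : (maxn N M <= n./2)%N by rewrite geq_half_double.
by rewrite geq_max /coords => /andP[? ?]; case: ifP => _; [exact: slN|exact: npM].
Qed.

(* [f - glue (slice f)] is the projection onto W.  Here and in [unfold_limit]
   it is combined with the glueing of the new null sequence. *)
Definition fold_omega (g : K * ord_1_omega -> X) (q : K) : X :=
  limit_part g q + glue (fun n r => coords g n r - slice (limit_part g) n r) q.

Definition unfold_limit (f : K -> X) (q : K) : X :=
  f q + glue (fun n r => slice f n.*2.+1 r - slice f n r) q.

(** Undoes the interleaving of [coords]: the even slices become the differences to the limit, the
    odd ones the slices of [unfold_limit f]. *)
Definition unfold_omega (f : K -> X) : K * ord_1_omega -> X :=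
  assemble (unfold_limit f) (fun n => slice f n.*2).

(** * Folding and unfolding preserve continuity and are mutually inverse *)

Lemma fold_omega_continuous g : continuous g -> continuous (fold_omega g).
Proof.
move=> gc; have lc : continuous (limit_part g) by exact: section_continuous.
have hc : continuous
    (glue (fun n r => coords g n r - slice (limit_part g) n r)).
  apply: glue_continuous => [n r|].
    by apply: cvgB; [exact: coords_continuous|exact: slice_continuous].
  by apply: vanishingB; [exact: coords_vanishing|exact: slice_vanishing].
by move=> q; apply: cvgD; [exact: lc|exact: hc].
Qed.

Lemma vanishing_subseq (s : nat -> nat) h : (forall n, (n <= s n)%N) ->
  vanishing h -> vanishing (h \o s).
Proof.
move=> ns h0 eps eps0; have [N _ hN] := h0 eps eps0.
by exists N => // n /= Nn; apply: hN => /=; exact: leq_trans (ns n).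
Qed.

Lemma unfold_omega_continuous f : continuous f -> continuous (unfold_omega f).
Proof.
move=> fc; have sc n := slice_continuous (n := n) fc.
have s0 := slice_vanishing fc.
have hc : continuous (glue (fun n r => slice f n.*2.+1 r - slice f n r)).
  apply: glue_continuous => [n r|]; first by apply: cvgB; exact: sc.
  apply: (@vanishingB (fun n => slice f n.*2.+1)) => //.
  by apply: (@vanishing_subseq (fun n => n.*2.+1)) => // n; rewrite -addnn leqW ?leq_addr.
apply: assemble_continuous => [q|n|]; [|exact: sc|].
  by apply: cvgD; [exact: fc|exact: hc].
by apply: (@vanishing_subseq double) => // n; rewrite -addnn leq_addr.
Qed.

(** [slice] is a left inverse of [glue], so the slices of the limit cancel against the subtracted
    ones. *)
Lemma slice_fold_omega g n : slice (fold_omega g) n = coords g n.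
Proof.
apply/funext => r.
by rewrite /slice /fold_omega linearD glueE incK addrC subrK.
Qed.

Lemma slice_unfold_limit f n : slice (unfold_limit f) n = slice f n.*2.+1.
Proof.
apply/funext => r.
by rewrite /slice /unfold_limit linearD glueE incK addrC subrK.
Qed.

Lemma glueN h q : glue (fun n r => - h n r) q = - glue h q.
Proof.
have [[n [r ->]]|qn] := range_or_not q; first by rewrite !glueE linearN.
by rewrite !glue0// oppr0.
Qed.

Lemma glue_linear (a : R) h k q :
  glue (fun n r => a *: h n r + k n r) q = a *: glue h q + glue k q.
Proof.
have [[n [r ->]]|qn] := range_or_not q; first by rewrite !glueE linearP.
by rewrite !glue0// scaler0 addr0.
Qed.

Lemma eq_glue h k q : (forall n r, h n r = k n r) -> glue h q = glue k q.
Proof. by move=> hk; congr glue; apply/funext => n; apply/funext => r. Qed.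

Lemma fold_omegaK : cancel fold_omega unfold_omega.
Proof.
move=> g.
have lE q : unfold_limit (fold_omega g) q = g (q, ord_omega).
  (* The two glued sequences are opposite, since the odd [coords] are the slices of the limit. *)
  rewrite {1}/unfold_limit {1}/fold_omega -addrA -[RHS]addr0; congr (_ + _).
  apply/eqP; rewrite addr_eq0 -glueN; apply/eqP.
  by apply: eq_glue => n r; rewrite !slice_fold_omega coords_odd opprB.
apply/funext => -[q [n|]]; rewrite /unfold_omega /assemble/= lE ?addr0//.
by rewrite slice_fold_omega coords_even /null_part addrC subrK.
Qed.

Lemma unfold_omegaK : cancel unfold_omega fold_omega.
Proof.
move=> f.
have lE : limit_part (unfold_omega f) = unfold_limit f.
  by apply/funext => q; rewrite /limit_part /unfold_omega /assemble/= addr0.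
(* Even and odd slices of [f] are interleaved back into their original order. *)
have cE n : coords (unfold_omega f) n = slice f n.
  rewrite /coords lE slice_unfold_limit; case: ifP => on.
    by rewrite -[in RHS](odd_double_half n) on.
  apply/funext => r; rewrite /null_part /unfold_omega /assemble/= addr0.
  by rewrite addrC addKr -[in RHS](odd_double_half n) on.
apply/funext => q; rewrite /fold_omega lE {1}/unfold_limit -addrA -[RHS]addr0.
congr (_ + _); apply/eqP; rewrite addr_eq0 -glueN; apply/eqP.
by apply: eq_glue => n r; rewrite cE slice_unfold_limit opprB.
Qed.

(** * Linearity and boundedness of the two maps *)

Definition foldC (g : Cspace (K * ord_1_omega)%type X) : Cspace K X :=
  mkcts (fold_omega_continuous (@cts_fun _ _ g)).

Definition unfoldC (f : Cspace K X) : Cspace (K * ord_1_omega)%type X :=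
  mkcts (unfold_omega_continuous (@cts_fun _ _ f)).

Lemma coords_linear (a : R) g h n r :
  coords (fun qa => a *: g qa + h qa) n r = a *: coords g n r + coords h n r.
Proof.
rewrite /coords; case: ifP => _; first by rewrite /slice /limit_part linearP.
by rewrite /null_part scalerBr opprD addrACA.
Qed.

Lemma foldC_linear : linear foldC.
Proof.
move=> a g h; apply/continuousEP => q.
rewrite -[LHS]/(fold_omega (fun qa => a *: g qa + h qa) q).
rewrite -[RHS]/(a *: fold_omega g q + fold_omega h q).
rewrite /fold_omega scalerDr addrACA; congr (_ + _).
rewrite -glue_linear; apply: eq_glue => n r.
by rewrite coords_linear scalerBr addrACA -opprD /slice /limit_part linearP.
Qed.

HB.instance Definition _ := GRing.isLinear.Build R _ _ _ foldC foldC_linear.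

Lemma foldCK : cancel foldC unfoldC.
Proof. by move=> g; apply/continuousEP => qa; exact: (congr1 (@^~ qa) (fold_omegaK g)). Qed.

Lemma unfoldCK : cancel unfoldC foldC.
Proof. by move=> f; apply/continuousEP => q; exact: (congr1 (@^~ q) (unfold_omegaK f)). Qed.

HB.instance Definition _ :=
  GRing.isLinear.Build R _ _ _ unfoldC (can2_linear foldCK unfoldCK).

(** The limit contributes 1 and the glued sequence 3: 2 for [coords], possibly a difference of two
    values, and 1 for the slice. *)
Lemma foldC_bounded g : `|foldC g| <= 4 * `|g|.
Proof.
have gM qa : `|g qa| <= `|g| by exact: ler_sup_norm.
apply: sup_norm_le => [|q]; first by rewrite mulr_ge0.
rewrite (_ : 4 * `|g| = `|g| + 3 * `|g|); last by ring.
apply: le_trans (ler_normD _ _) _; apply: lerD; first exact: gM.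
apply: glue_le => [|n r]; first by rewrite mulr_ge0.
rewrite (_ : 3 * `|g| = 2 * `|g| + `|g|); last by ring.
apply: le_trans (ler_normB _ _) _; apply: lerD; last first.
  by apply: slice_le => s; exact: gM.
rewrite /coords; case: ifP => _.
  apply: le_trans (_ : `|g| <= _); first by apply: slice_le => s; exact: gM.
  by rewrite ler_peMl// ler1n.
by rewrite mulr_natl mulr2n; apply: le_trans (ler_normB _ _) _; exact: lerD.
Qed.

(** Here [f] contributes 1, the glued difference of slices 2 and the even slice 1. *)
Lemma unfoldC_bounded f : `|unfoldC f| <= 4 * `|f|.
Proof.
have fM q : `|f q| <= `|f| by exact: ler_sup_norm.
apply: sup_norm_le => [|[q a]]; first by rewrite mulr_ge0.
rewrite (_ : 4 * `|f| = `|f| + (`|f| + `|f|) + `|f|); last by ring.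
apply: le_trans (ler_normD _ _) _; apply: lerD; last first.
  by case: a => [n|]; [exact: slice_le|rewrite normr0].
apply: le_trans (ler_normD _ _) _; apply: lerD => //.
apply: glue_le => [|n r]; first by rewrite addr_ge0.
by apply: le_trans (ler_normB _ _) _; apply: lerD; exact: slice_le.
Qed.

Lemma isomorphic_self_similar :
  isomorphic (Cspace (K * ord_1_omega)%type X) (Cspace K X).
Proof.
exists foldC, unfoldC; split; [exact: foldCK|exact: unfoldCK| |].
  exact: (bounded_continuous _ _ foldC_bounded).
exact: (bounded_continuous _ _ unfoldC_bounded).
Qed.

End self_similar.

(** * Shifts on [lp] *)

Section lp_shift.
Set Implicit Arguments.
Unset Strict Implicit.
Variables (R : realType) (p : R) (p1 : 1 <= p).
Local Notation mu := (@counting nat R).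
Implicit Types x : lp p1.

Let p_gt0 : 0 < p. Proof. exact: lt_le_trans p1. Qed.

(** The norm is the [p]-th root of a limit of partial sums, and the root is monotone. Membership in
    [lp] and the norm estimates for the shifts reduce to this. *)
Lemma Lnorm_counting_le (u : nat -> R) (M : R) : 0 <= M ->
  (forall n, \sum_(k < n) `|u k| `^ p <= M `^ p) ->
  ('N[mu]_p%:E [EFin \o u] <= M%:E)%E.
Proof.
move=> M0 uM; rewrite Lnorm_counting//.
have -> : M%:E = ((M `^ p)%:E `^ p^-1)%E.
  by rewrite poweR_EFin -powRrM mulfV ?gt_eqF// powRr1.
have un0 k : (0%N <= k)%N -> true -> (0 <= (`|u k| `^ p)%:E)%E.
  by rewrite lee_fin powR_ge0.
apply: gt0_ler_poweR; rewrite ?invr_ge0 ?(ltW p_gt0)// ?in_itv/= ?leey ?andbT.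
- exact: nneseries_ge0.
- by rewrite lee_fin powR_ge0.
apply: lime_le; first exact: is_cvg_nneseries.
by apply: nearW => n; rewrite big_mkord sumEFin lee_fin; exact: uM.
Qed.

Lemma Lfun_counting (u : nat -> R) (M : R) : 0 <= M ->
  (forall n, \sum_(k < n) `|u k| `^ p <= M `^ p) -> u \in Lfun mu p%:E.
Proof.
move=> M0 /(Lnorm_counting_le M0) uM; apply/andP; split; first exact/mem_set.
by apply/mem_set; rewrite /= /finite_norm (le_lt_trans uM)// ltry.
Qed.

Lemma lp_norm_le x (M : R) : 0 <= M ->
  (forall n, \sum_(k < n) `|x k| `^ p <= M `^ p) -> `|x| <= M.
Proof.
move=> M0 /(Lnorm_counting_le M0).
by rewrite -lee_fin lpNormE /lp_norm finite_norm_fine.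
Qed.

Lemma sum_shift_left_le x n m :
  \sum_(k < m) `|x (n + k)%N| `^ p <= `|x| `^ p.
Proof.
apply: le_trans (lp_norm_sum_le x (n + m)).
by rewrite big_split_ord/= lerDr sumr_ge0// => k _; exact: powR_ge0.
Qed.

Definition shift_left n x : lp p1 :=
  Lfun_Sub (lp_exponent p1)
    (@Lfun_counting (fun k => x (n + k)%N) _ (normr_ge0 x) (sum_shift_left_le x n)).

Lemma shift_left_linear n : linear (shift_left n).
Proof. by move=> a x y; apply/LfuneqP. Qed.

HB.instance Definition _ n :=
  GRing.isLinear.Build R _ _ _ (shift_left n) (shift_left_linear n).

Lemma shift_left_le n x : `|shift_left n x| <= `|x|.
Proof. by apply: lp_norm_le => // m; exact: sum_shift_left_le. Qed.

(** The [p]-th powers of the norms are tails of a convergent series. *)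
Lemma cvg_shift_left x : shift_left n x @[n --> \oo] --> (0 : lp p1).
Proof.
pose s n := \sum_(k < n) `|x k| `^ p.
have s_nd : nondecreasing_seq s.
  apply/nondecreasing_seqP => n.
  by rewrite /s big_ord_recr/= lerDl powR_ge0.
have s_ub : has_ubound (range s).
  by exists (`|x| `^ p) => _ [n _ <-]; exact: lp_norm_sum_le.
have s_cvg := nondecreasing_cvgn s_nd s_ub.
apply/cvgrPdist_le => eps eps0.
move/cvgrPdist_le : s_cvg => /(_ _ (powR_gt0 p eps0)).
apply: filterS => n sn; rewrite sub0r normrN.
apply: lp_norm_le => [|m]; first exact: ltW.
have -> : \sum_(k < m) `|shift_left n x k| `^ p = s (n + m)%N - s n.
  by rewrite /s big_split_ord/= [RHS]addrC addKr.
(* The block [s (n + m) - s n] is at most the distance from [s n] to the supremum of [s]. *)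
apply: le_trans sn; apply: le_trans (ler_norm _); apply: lerB => //.
by apply: ub_le_sup => //; exists (n + m)%N.
Qed.

Definition shift_right_seq n x k : R := if (k < n)%N then 0 else x (k - n)%N.

Lemma sum_shift_right_le x n m :
  \sum_(k < m) `|shift_right_seq n x k| `^ p <= `|x| `^ p.
Proof.
apply: le_trans (lp_norm_sum_le x m).
(* With [n + m] terms the sum splits into [n] zeros and the first [m] terms of [x]. *)
apply: (@le_trans _ _ (\sum_(k < n + m) `|shift_right_seq n x k| `^ p)).
  rewrite addnC big_split_ord/= lerDl sumr_ge0// => k _; exact: powR_ge0.
rewrite big_split_ord/= big1 ?add0r => [|k _]; last first.
  by rewrite /shift_right_seq ltn_ord normr0 powR0// gt_eqF.
apply: ler_sum => k _.
by rewrite /shift_right_seq ltnNge leq_addr/= addKn.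
Qed.

Definition shift_right n x : lp p1 :=
  Lfun_Sub (lp_exponent p1)
    (@Lfun_counting (shift_right_seq n x) _ (normr_ge0 x) (sum_shift_right_le x n)).

Lemma shift_right_linear n : linear (shift_right n).
Proof.
move=> a x y; apply/LfuneqP => k.
rewrite -[LHS]/(shift_right_seq n (a *: x + y) k).
rewrite -[RHS]/(a * shift_right_seq n x k + shift_right_seq n y k).
by rewrite /shift_right_seq; case: ifP => // _; rewrite mulr0 addr0.
Qed.

HB.instance Definition _ n :=
  GRing.isLinear.Build R _ _ _ (shift_right n) (shift_right_linear n).

Lemma shift_right_le n x : `|shift_right n x| <= `|x|.
Proof. by apply: lp_norm_le => // m; exact: sum_shift_right_le. Qed.

Lemma shift_rightK n : cancel (shift_right n) (shift_left n).
Proof.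
move=> x; apply/LfuneqP => k.
rewrite -[LHS]/(shift_right_seq n x (n + k)%N).
by rewrite /shift_right_seq ltnNge leq_addr/= addKn.
Qed.

End lp_shift.

(** * Disjoint clopen copies of [betaN] inside itself *)

Lemma nat_pairing : exists (pair : nat -> nat -> nat) (left right : nat -> nat),
  [/\ forall n k, left (pair n k) = n, forall n k, right (pair n k) = k &
      forall t, pair (left t) (right t) = t].
Proof.
have /card_set_bijP[f [_ finj fsurj]] := card_nat2.
have fK t : {nk | f nk = t} by apply: cid; have [nk _ <-] := fsurj t I; exists nk.
have gK nk : sval (fK (f nk)) = nk by apply: finj; rewrite ?in_setT//; exact: (svalP (fK _)).
exists (fun n k => f (n, k)), (fun t => (sval (fK t)).1), (fun t => (sval (fK t)).2).
by split => [n k|n k|t]; rewrite ?gK// -surjective_pairing; exact: (svalP (fK _)).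
Qed.

Section betaN_map.
Implicit Types (s : nat -> nat) (q : betaN).

Lemma fmap_ultra (T U : Type) (f : T -> U) (F : set_system T) :
  UltraFilter F -> UltraFilter (f @ F).
Proof.
move=> UF; split=> [|G GF FG]; first exact: fmap_proper_filter.
apply/seteqP; split => // B GB.
have [//|FnB] := in_ultra_setVsetC (f @^-1` B) UF.
have GnB : G (~` B) by exact: FG.
by have [n []] := filter_ex (filterI GB GnB).
Qed.

(** The continuous extension of [s] to [betaN], as pushforward of ultrafilters. *)
Definition betaN_map s q : betaN := BetaN (fmap_ultra s (ultra_setsP q)).

Lemma betaN_map_continuous s : continuous (betaN_map s).
Proof.
move=> q U /nbhs_betaNP[A qA AU]; apply/nbhs_betaNP; exists (s @^-1` A) => // r rA.
exact: AU.
Qed.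

Lemma betaN_mapK s t : cancel s t -> cancel (betaN_map s) (betaN_map t).
Proof.
move=> st q; apply: betaN_eqP => A.
apply: (@filterS _ (ultra_sets q) _ (fun n => A (t (s n)))) => n.
by rewrite st.
Qed.

End betaN_map.

(** The fibres of [left] partition [nat] into infinite sets. Pushing forward along [pair n] maps
    [betaN] onto the cylinder of the [n]-th fibre, and [right] renumbers every fibre back. *)
Lemma betaN_self_similar : exists (e : nat -> betaN -> betaN) (d : betaN -> betaN),
  [/\ forall n, continuous (e n), continuous d, forall n, cancel (e n) d,
      forall m n q r, e m q = e n r -> m = n & forall n, open (range (e n))].
Proof.
have [pair [left [right [leftE rightE pairE]]]] := nat_pairing.
exists (fun n => betaN_map (pair n)), (betaN_map right); split.
- by move=> n; exact: betaN_map_continuous.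
- exact: betaN_map_continuous.
- by move=> n; apply: betaN_mapK; exact: rightE.
- move=> m n q r eqr.
  (* The fibre over [m] belongs to [e m q], hence to [e n r]; its preimage under [pair n] is
     nonempty only if [m = n]. *)
  have : ultra_sets r [set k | left (pair n k) = m].
    rewrite -[ultra_sets r _]/(ultra_sets (betaN_map (pair n) r) [set t | left t = m]).
    rewrite -eqr; apply: (@filterS _ (ultra_sets q) _ setT) => [k _|].
      exact: leftE.
    exact: filterT.
  by move=> /filter_ex[k]; rewrite /= leftE.
- move=> n; rewrite (_ : range _ = betaN_cylinder [set t | left t = n]).
    exact: open_betaN_cylinder.
  apply/seteqP; split => [_ [q _ <-]|q qn].
    apply: (@filterS _ (ultra_sets q) _ setT) => [k _|]; first exact: leftE.
    exact: filterT.
  (* On the fibre over [n], which belongs to [q], [pair n] inverts [right]. *)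
  exists (betaN_map right q) => //; apply/esym/betaN_eqP => A qA.
  apply: (@filterS _ (ultra_sets q) _ _ (fun t => A (pair n (right t))) _
    (filterI qA qn)) => t [At /= <-].
  by rewrite pairE.
Qed.

Theorem theorem5p4 (R : realType) (p : R) (p1 : 1 <= p) :
  isomorphic (Cspace (betaN * ord_1_omega)%type (lp p1))
             (Cspace betaN (lp p1)).
Proof.
have [e [d [ec dc eK einj eo]]] := betaN_self_similar.
apply: (isomorphic_self_similar ec dc eK einj eo) => [n x|n x|n|x].
- exact: shift_right_le.
- exact: shift_left_le.
- exact: shift_rightK.
- exact: cvg_shift_left.
Qed.
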